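(* Let $(G,i)$ be a rooted graph in which $i$ is a cut-vertex of $G$. Then $(G,i)$ allows the nullity pair $(1,2)$.
   Context: All matrices are real. For a simple graph $G$ on $[n]$, $\mathcal{S}(G)$ is the set of real symmetric $n\times n$ matrices whose off-diagonal $(j,k)$ entry is nonzero iff $\{j,k\}\in E(G)$ (diagonal free). $A(i)$ is $A$ with row and column $i$ deleted. $(G,i)$ allows the nullity pair $(k,\ell)$ if some $A\in\mathcal{S}(G)$ has $(\operatorname{null}(A),\operatorname{null}(A(i)))=(k,\ell)$. A cut-vertex is a vertex whose removal increases the number of connected components. *)

(* Defs.v *)
From mathcomp Require Import all_boot all_order all_algebra.
From mathcomp Require Import reals.

Set Implicit Arguments.
Unset Strict Implicit.
Unset Printing Implicit Defensive.

Import GRing.Theory.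
Local Open Scope ring_scope.

Record sgraph (n : nat) := SGraph {
  adj :> rel 'I_n;
  adj_sym : symmetric adj;
  adj_irrefl : irreflexive adj
}.

(* G - i: its vertices are reindexed by lift i : 'I_n.-1 -> 'I_n, the increasing
   enumeration of the vertices other than i. This is also the indexing used by
   row' and col', so that it agrees with that of principal_del below. *)
Definition del_vertex (n : nat) (G : sgraph n) (i : 'I_n) : sgraph n.-1 :=
  @SGraph n.-1 (relpre (lift i) G)
    (fun x y => adj_sym G (lift i x) (lift i y))
    (fun x => adj_irrefl G (lift i x)).

Definition num_components (n : nat) (G : sgraph n) : nat := n_comp G predT.

Definition cut_vertex (n : nat) (G : sgraph n) (i : 'I_n) : Prop :=
  (num_components G < num_components (del_vertex G i))%N.

Definition graph_matrix (R : realType) (n : nat) (G : sgraph n) (A : 'M[R]_n) :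
    Prop :=
  A^T = A /\ (forall j k : 'I_n, j != k -> (A j k != 0) = G j k).

Definition principal_del (R : realType) (n : nat) (A : 'M[R]_n) (i : 'I_n) :
    'M[R]_n.-1 :=
  row' i (col' i A).

(* The row space of kermx A^T consists of the transposes of the column vectors x
   with A *m x = 0. *)
Definition nullity (R : realType) (n : nat) (A : 'M[R]_n) : nat :=
  \rank (kermx A^T).

Definition allows_nullity_pair (R : realType) (n : nat) (G : sgraph n)
    (i : 'I_n) (k l : nat) : Prop :=
  exists A : 'M[R]_n,
    graph_matrix G A /\ (nullity A, nullity (principal_del A i)) = (k, l).

(* Main.v *)
Require Import Defs.
From mathcomp Require Import all_boot all_order all_algebra.
From mathcomp Require Import reals.
From mathcomp Require Import ring.

Set Implicit Arguments.
Unset Strict Implicit.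
Unset Printing Implicit Defensive.

Import Order.TTheory GRing.Theory Num.Theory.
Local Open Scope ring_scope.

(** If [i] is a cut-vertex, it has neighbours [a] and [b] lying in different
    components of [G - i]. On [G - i] take the graph Laplacian, plus the identity
    on the components of neither [a] nor [b]: it is positive semidefinite, and its
    kernel is spanned by the indicator vectors of the components of [a] and [b].
    Border it by minus the incidence vector of the neighbourhood of [i] and a zero
    diagonal entry. That border pairs nontrivially with both indicators, so a
    null vector vanishes at [i] and is a combination of the two indicators
    orthogonal to the border, which leaves a line. *)

(** * Connectivity around a cut-vertex *)

Lemma connect_sgraph_sym n (G : sgraph n) : connect_sym G.
Proof. exact/sym_connect_sym/adj_sym. Qed.

(** By contraposition: if all neighbours of [i] lie in one component of [G - i], every passage of a
    path through [i] can be bypassed. Distinct components of [G - i] then stay distinct in [G], so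
    deleting [i] does not raise their number. *)
Lemma cut_vertex_neighbours n (G : sgraph n) (i : 'I_n) :
  cut_vertex G i ->
  exists a b : 'I_n.-1, [/\ G i (lift i a), G i (lift i b)
    & ~~ connect (del_vertex G i) a b].
Proof.
move=> cut_i; set G' := del_vertex G i.
have symG' := connect_sgraph_sym G'.
have [/existsP[a /existsP[b /and3P[ia ib nab]]]|no_sep] := boolP
  [exists a, exists b, [&& G i (lift i a), G i (lift i b) & ~~ connect G' a b]].
  by exists a, b.
have joined a b : G i (lift i a) -> G i (lift i b) -> connect G' a b.
  move=> ia ib; apply/negPn/negP => nab; case/negP: no_sep.
  by apply/existsP; exists a; apply/existsP; exists b; rewrite ia ib.
suff connect_lift r s : connect G (lift i r) (lift i s) -> connect G' r s.
  move: cut_i; rewrite /cut_vertex /num_components ltnNge => /negP[].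
  (* Components are counted by canonical roots. [connect_lift] makes [f] injective on the roots of
     [G'], and its values are roots of [G]. *)
  pose f r := fingraph.root G (lift i r).
  rewrite /n_comp_mem -(@card_in_image _ _ f); last first.
    move=> r s; rewrite !inE !andbT => /eqP rootr /eqP roots /eqP.
    rewrite root_connect; last exact: connect_sgraph_sym.
    by move/connect_lift; rewrite -root_connect // rootr roots => /eqP.
  apply: subset_leq_card; apply/subsetP => _ /imageP[r _ ->].
  by rewrite !inE andbT; apply: roots_root; apply: connect_sgraph_sym.
(* [C] is the component of [r] in [G'], enlarged by [i] when it contains a neighbour of [i]. By
   [joined] no edge of [G] leaves it, even through [i]. *)
pose C y := if unlift i y is Some t then connect G' r t
  else [exists u, G i (lift i u) && connect G' r u].
have C_step y z : G y z -> C y -> C z.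
  rewrite /C; case: unliftP => [t ->|->]; case: unliftP => [u ->|->] yz.
  - by move/connect_trans; apply; apply: connect1.
  - by move=> rt; apply/existsP; exists t; rewrite adj_sym yz.
  - case/existsP=> v /andP[iv rv]; apply: connect_trans rv _; exact: joined.
  - by rewrite adj_irrefl in yz.
have C_closed : closed G C.
  move=> y z yz; rewrite -!topredE /=; apply/idP/idP; apply: C_step => //.
  by rewrite adj_sym.
move/(closed_connect C_closed); rewrite -!topredE /= /C !liftK connect0.
by move=> <-.
Qed.

(** * Graph Laplacian with a diagonal shift *)

Section ShiftedLaplacian.
Variables (R : realFieldType) (m : nat) (G : sgraph m) (c : 'I_m -> R).

Definition shifted_laplacian : 'M[R]_m :=
  \matrix_(s, t) ((\sum_u (G s u)%:R + c s) *+ (s == t) - (G s t)%:R).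

Lemma trmx_shifted_laplacian : shifted_laplacian^T = shifted_laplacian.
Proof.
apply/matrixP => s t; rewrite !mxE adj_sym eq_sym.
by case: eqVneq => [->|].
Qed.

Lemma mul_shifted_laplacianE p (Y : 'M_(p, m)) q s :
  (Y *m shifted_laplacian) q s
    = \sum_t (G s t)%:R * (Y q s - Y q t) + c s * Y q s.
Proof.
rewrite mxE; under eq_bigr => t _ do rewrite !mxE mulrBr.
rewrite sumrB (bigD1 s) //= eqxx mulr1n [X in _ + X - _]big1 ?addr0; last first.
  by move=> t /negPf ->; rewrite mulr0n mulr0.
under [in RHS]eq_bigr => t _ do rewrite mulrBr.
rewrite sumrB -mulr_suml.
have -> : \sum_t Y q t * (G t s)%:R = \sum_t (G s t)%:R * Y q t.
  by apply: eq_bigr => t _; rewrite adj_sym mulrC.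
by ring.
Qed.

(** The quadratic form at [y] is half the sum over ordered pairs of adjacent vertices of squared
    differences, plus the sum of [c s * y 0 s ^+ 2]. Each term is nonnegative, so all vanish on the
    kernel. *)
Lemma shifted_laplacian_ker (y : 'rV_m) :
  (forall s, 0 <= c s) -> y *m shifted_laplacian = 0 ->
  (forall s t, connect G s t -> y 0 s = y 0 t) /\ (forall s, c s * y 0 s = 0).
Proof.
move=> c_ge0 yB0.
pose E s t := (G s t)%:R * (y 0 s - y 0 t) ^+ 2.
pose D s := \sum_t E s t + 2 * (c s * y 0 s ^+ 2).
have E_ge0 s t : 0 <= E s t by rewrite mulr_ge0 ?ler0n ?sqr_ge0.
have cy_ge0 s : 0 <= 2 * (c s * y 0 s ^+ 2) by apply: mulr_ge0; rewrite ?ler0n //; apply: mulr_ge0; rewrite ?sqr_ge0.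
have sumE_ge0 s : 0 <= \sum_t E s t by apply: sumr_ge0.
have D_ge0 s : true -> 0 <= D s by move=> _; rewrite addr_ge0.
have sumD0 : \sum_s D s = 0.
  (* The sum of [D] is twice the quadratic form: [E s t = F s t + F t s], and both halves have the
     same total after exchanging the summations. *)
  pose F s t := (G s t)%:R * (y 0 s - y 0 t) * y 0 s.
  have FE : \sum_s D s = 2 * \sum_s (\sum_t F s t + c s * y 0 s ^+ 2).
    rewrite !big_split /= mulrDr -mulr_sumr; congr (_ + _).
    rewrite mulr_natl mulr2n [X in _ = _ + X]exchange_big -big_split; apply: eq_bigr => s _.
    rewrite -big_split; apply: eq_bigr => t _ /=.
    by rewrite /E /F (adj_sym G t s); ring.
  rewrite FE big1 ?mulr0 // => s _.
  rewrite -mulr_suml expr2 mulrA -mulrDl -mul_shifted_laplacianE yB0 mxE.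
  by rewrite mul0r.
have D0 s : D s = 0 by exact: (psumr_eq0P D_ge0 sumD0).
have split0 s : (\sum_t E s t == 0) && (2 * (c s * y 0 s ^+ 2) == 0).
  by rewrite -paddr_eq0 // -[_ + _]/(D s) D0.
have edge s t : G s t -> y 0 s = y 0 t.
  move=> st; have /andP[/eqP E0 _] := split0 s.
  have /eqP : E s t = 0 by apply: (psumr_eq0P (fun t _ => E_ge0 s t) E0).
  by rewrite /E st mul1r sqrf_eq0 subr_eq0 => /eqP.
split=> [s t /connectP[p]|s].
  elim: p s => [|u p IHp] s /= => [_ ->|/andP[su pathp] lastp] //.
  by rewrite (edge _ _ su); apply: IHp.
have /andP[_] := split0 s; rewrite !mulf_eq0 orbb pnatr_eq0 /=.
by rewrite -mulf_eq0 => /eqP.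
Qed.

End ShiftedLaplacian.

(** * Kernel spanned by the indicators of chosen components *)

Section ComponentKernel.
Variables (R : realFieldType) (m p : nat) (G : sgraph m) (f : 'I_p -> 'I_m).
Hypothesis f_sep : forall q r, connect G (f q) (f r) -> q = r.

Definition component_mx : 'M[R]_(p, m) :=
  \matrix_(q, s) (connect G (f q) s)%:R.

Definition component_laplacian : 'M[R]_m :=
  shifted_laplacian G (fun s => (~~ [exists q, connect G (f q) s])%:R).

Lemma component_mx_free : row_free component_mx.
Proof.
(* Evaluation at the representatives [f q] is a right inverse, since they lie in distinct
   components. *)
apply/row_freeP; exists (\matrix_(s, q) (s == f q)%:R).
apply/matrixP => q r; rewrite !mxE (bigD1 (f r)) //= !mxE eqxx mulr1.
rewrite big1 ?addr0 => [|s /negPf]; last by rewrite !mxE => ->; rewrite mulr0.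
case: eqVneq => [->|/eqP neq]; first by rewrite connect0.
by case: (boolP (connect _ _ _)) => // /f_sep.
Qed.

Lemma component_mx_ker : component_mx *m component_laplacian = 0.
Proof.
apply/matrixP => q s; rewrite mul_shifted_laplacianE !mxE big1 ?add0r.
  case: existsP => [_|no_q]; first by rewrite mul0r.
  by case: (boolP (connect _ _ _)) => [qs|_]; [case: no_q; exists q|rewrite mulr0].
move=> t _; rewrite !mxE; case: (boolP (G s t)) => [st|]; last by rewrite mul0r.
have conn_st : connect G s t by apply: connect1.
by rewrite (same_connect_r (connect_sgraph_sym G) conn_st) subrr mulr0.
Qed.

(** A null vector is constant on each component and, the shift being 1 there, zero off the chosen
    ones; its coefficients are its values at the representatives. *)
Lemma component_laplacian_kerE (y : 'rV_m) :
  y *m component_laplacian = 0 -> y = (\row_q y 0 (f q)) *m component_mx.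
Proof.
case/shifted_laplacian_ker => [s|const vanish]; first exact: ler0n.
apply/rowP => s; rewrite mxE; have := vanish s.
case: existsP => [[q qs] _|no_q] /=.
  rewrite (bigD1 q) //= !mxE qs mulr1 (const _ _ qs) big1 ?addr0 // => r.
  rewrite !mxE; case: (boolP (connect G (f r) s)) => [rs|_ _]; last by rewrite mulr0.
  case/eqP; apply: f_sep; apply: connect_trans rs _.
  by rewrite connect_sgraph_sym.
rewrite mul1r => ->; rewrite big1 // => q _; rewrite !mxE.
by case: (boolP (connect _ _ _)) => [qs|_]; [case: no_q; exists q|rewrite mulr0].
Qed.

Lemma rank_ker_component_laplacian : \rank (kermx component_laplacian) = p.
Proof.
rewrite -(eqP component_mx_free); apply/eqmx_rank/andP; split.
  apply/rV_subP => y /sub_kermxP /component_laplacian_kerE ->.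
  exact: submxMl.
exact/sub_kermxP/component_mx_ker.
Qed.

End ComponentKernel.

(** * Bordering by the neighbourhood of the root *)

Section BorderedMatrix.
Variables (R : realFieldType) (n : nat) (G : sgraph n) (i : 'I_n) (B : 'M[R]_n.-1).

(** The default branch also covers the corner [(i, i)], where irreflexivity of [G] gives zero. *)
Definition bordered_mx : 'M[R]_n :=
  \matrix_(j, k) if (unlift i j, unlift i k) is (Some s, Some t) then B s t
                 else - (G j k)%:R.

Lemma bordered_mx_lift s t : bordered_mx (lift i s) (lift i t) = B s t.
Proof. by rewrite mxE !liftK. Qed.

Lemma bordered_mx_root k : bordered_mx i k = - (G i k)%:R.
Proof. by rewrite mxE unlift_none. Qed.

Lemma bordered_mx_col j : bordered_mx j i = - (G j i)%:R.
Proof. by rewrite mxE unlift_none; case: unlift. Qed.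

Lemma trmx_bordered_mx : B^T = B -> bordered_mx^T = bordered_mx.
Proof.
move=> symB; apply/matrixP => j k; rewrite !mxE adj_sym.
by case: unlift => [s|]; case: unlift => [t|] //; rewrite -{1}symB mxE.
Qed.

Lemma mul_bordered_mx_lift (x : 'rV_n) s :
  (x *m bordered_mx) 0 (lift i s)
    = - x 0 i * (G i (lift i s))%:R + (col' i x *m B) 0 s.
Proof.
rewrite !mxE (bigD1_ord i) //= bordered_mx_root mulrN mulNr; congr (_ + _).
by apply: eq_bigr => t _; rewrite bordered_mx_lift !mxE.
Qed.

Lemma mul_bordered_mx_root (x : 'rV_n) :
  (x *m bordered_mx) 0 i = - \sum_s col' i x 0 s * (G i (lift i s))%:R.
Proof.
rewrite !mxE (bigD1_ord i) //= bordered_mx_root adj_irrefl oppr0 mulr0 add0r.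
rewrite -sumrN; apply: eq_bigr => t _.
by rewrite bordered_mx_col adj_sym mulrN mxE.
Qed.

End BorderedMatrix.

Lemma graph_matrix_bordered_laplacian (R : realType) n (G : sgraph n) (i : 'I_n)
    (c : 'I_n.-1 -> R) :
  graph_matrix G (bordered_mx G i (shifted_laplacian (del_vertex G i) c)).
Proof.
split; first exact/trmx_bordered_mx/trmx_shifted_laplacian.
move=> j k; case: (unliftP i j) => [s ->|->]; last first.
  by rewrite bordered_mx_root oppr_eq0 pnatr_eq0; case: (G _ _).
case: (unliftP i k) => [t ->|->]; last first.
  by rewrite bordered_mx_col oppr_eq0 pnatr_eq0; case: (G _ _).
rewrite (inj_eq lift_inj) bordered_mx_lift !mxE => /negPf ->.
by rewrite mulr0n sub0r oppr_eq0 pnatr_eq0 /=; case: (G _ _).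
Qed.

Lemma rank_ker_bordered_component_laplacian (R : realFieldType) n (G : sgraph n)
    (i : 'I_n) (f : 'I_2 -> 'I_n.-1) :
  (forall q, G i (lift i (f q))) ->
  (forall q r, connect (del_vertex G i) (f q) (f r) -> q = r) ->
  \rank (kermx (bordered_mx G i (component_laplacian R (del_vertex G i) f)))
    = 1%N.
Proof.
move=> adjf f_sep; set G' := del_vertex G i.
set B := component_laplacian R G' f; set A := bordered_mx G i B.
pose K := component_mx R G' f.
pose b : 'cV[R]_n.-1 := \col_s (G i (lift i s))%:R.
(* [d q] counts the neighbours of [i] in the component of [f q]; it is positive because [f q] is one
   of them. *)
pose d q := (K *m b) q 0.
have d_gt0 q : 0 < d q.
  rewrite /d mxE (bigD1 (f q)) //= !mxE connect0 adjf mul1r.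
  rewrite ltr_pwDl ?ltr01 // sumr_ge0 // => s _.
  by rewrite !mxE -natrM ler0n.
have symB : B^T = B by apply: trmx_shifted_laplacian.
(* [e] is orthogonal to [(d 0, d 1)], so the combination [e *m K] of the indicators pairs to zero
   with the border. *)
pose e : 'rV[R]_2 := \row_q (if q == 0 then d 1 else - d 0).
pose w : 'rV[R]_n := \row_j (if unlift i j is Some s then (e *m K) 0 s else 0).
have col'w : col' i w = e *m K by apply/rowP => s; rewrite !mxE liftK mxE.
have rootw : w 0 i = 0 by rewrite mxE unlift_none.
have pair_border (x : 'rV_n) : (x *m A) 0 i = - (col' i x *m b) 0 0.
  rewrite mul_bordered_mx_root [in RHS]mxE; congr (- _).
  by apply: eq_bigr => s _; rewrite [b _ _]mxE.
have pair_K (g : 'rV_2) : (g *m K *m b) 0 0 = g 0 0 * d 0 + g 0 1 * d 1.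
  rewrite -mulmxA mxE big_ord_recl big_ord1 /d.
  by have -> : lift ord0 ord0 = 1 :> 'I_2 by apply: val_inj.
have wA0 : w *m A = 0.
  apply/rowP => j; rewrite [RHS]mxE; case: (unliftP i j) => [s ->|->].
    rewrite mul_bordered_mx_lift rootw col'w -mulmxA component_mx_ker mulmx0.
    by rewrite mxE oppr0 mul0r addr0.
  by rewrite pair_border col'w pair_K !mxE /=; ring.
have w_neq0 : w != 0.
  apply/eqP => w0; have : e *m K = 0 by rewrite -col'w w0; apply/rowP => s; rewrite !mxE.
  move/eqP; rewrite -[0](mul0mx _ K) (inj_eq (row_free_inj (component_mx_free R f_sep))).
  by move/eqP/rowP/(_ 0); rewrite !mxE /= => d0; have := d_gt0 1; rewrite d0 ltxx.
suff -> : \rank (kermx A) = \rank w by rewrite rank_rV w_neq0.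
apply/eqmx_rank/andP; split; last exact/sub_kermxP.
apply/rV_subP => x /sub_kermxP xA0.
have x_lift : col' i x *m B = x 0 i *: b^T.
  apply/rowP => s; have := mul_bordered_mx_lift G i B x s.
  rewrite -/A xA0 [X in X = _]mxE mulNr addrC => /esym/eqP; rewrite subr_eq0 => /eqP ->.
  by rewrite !mxE.
have x_root : x 0 i = 0.
  (* Pairing with the indicator of a component kills the Laplacian term. *)
  have := congr1 (mulmx ^~ K^T) x_lift; rewrite -mulmxA -[B in LHS]symB -trmx_mul.
  rewrite component_mx_ker trmx0 mulmx0 -scalemxAl -trmx_mul.
  move/rowP/(_ 0)/esym/eqP; rewrite 2!mxE -/(d 0) [X in _ == X]mxE mulf_eq0.
  by rewrite (gt_eqF (d_gt0 0)) orbF => /eqP.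
have := x_lift; rewrite x_root scale0r => /(component_laplacian_kerE f_sep).
set g := \row_q _ => xE.
have /eqP : (x *m A) 0 i = 0 by rewrite xA0 mxE.
rewrite pair_border xE pair_K oppr_eq0 => /eqP gd0.
have d1_neq0 : d 1 != 0 by rewrite gt_eqF.
(* By [gd0], [g] is orthogonal to [(d 0, d 1)] too, hence a multiple of [e]; the ratio is read off
   at index 0, where [e] takes the value [d 1]. *)
have gE : g = (g 0 0 / d 1) *: e.
  apply/rowP => q; rewrite [RHS]mxE [e _ _]mxE.
  case: (q =P 0) => [->|q_neq0]; first by rewrite divfK.
  have -> : q = 1.
    by case: q q_neq0 => -[|[|//]] ? neq0; [case: neq0|]; apply: val_inj.
  apply: (mulIf d1_neq0); rewrite mulrAC divfK //.
  by apply/eqP; rewrite -subr_eq0 mulrN opprK addrC gd0.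
apply/sub_rVP; exists (g 0 0 / d 1); apply/rowP => j; rewrite [RHS]mxE.
case: (unliftP i j) => [s ->|->]; last by rewrite x_root rootw mulr0.
have -> : x 0 (lift i s) = (g *m K) 0 s by rewrite -xE mxE.
have -> : w 0 (lift i s) = (e *m K) 0 s by rewrite -col'w [RHS]mxE.
by rewrite {1}gE -scalemxAl mxE.
Qed.

Theorem proposition5p9 (R : realType) (n : nat) (G : sgraph n) (i : 'I_n) :
  cut_vertex G i -> allows_nullity_pair R G i 1 2.
Proof.
move=> /cut_vertex_neighbours[a [b [ia ib nab]]].
pose f (q : 'I_2) := if q == 0 then a else b.
have adjf q : G i (lift i (f q)) by rewrite /f; case: ifP.
have f_sep q r : connect (del_vertex G i) (f q) (f r) -> q = r.
  rewrite /f; case: q => -[|[|//]] ?; case: r => -[|[|//]] ? /=;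
    do ?by move=> _; apply: val_inj.
    by rewrite (negPf nab).
  by rewrite (connect_sgraph_sym (del_vertex G i)) (negPf nab).
pose B := component_laplacian R (del_vertex G i) f.
have symB : B^T = B by apply: trmx_shifted_laplacian.
exists (bordered_mx G i B); split; first exact: graph_matrix_bordered_laplacian.
have -> : principal_del (bordered_mx G i B) i = B.
  by apply/matrixP => s t; rewrite !mxE !liftK !mxE.
(* Symmetry removes the transpose in [nullity], leaving the two left kernels already computed. *)
rewrite /nullity (trmx_bordered_mx G i symB) symB.
by rewrite rank_ker_bordered_component_laplacian // rank_ker_component_laplacian.
Qed.
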